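(* For each integer $m\ge 2$ there exist two (spherically) inequivalent monomial mappings in $P(2,2m+1)$ of degree $4m-1$.
   Context: $S^{2n-1}$ denotes the unit sphere in $\mathbf{C}^n$ and $\mathbf{B}_n$ the open unit ball in $\mathbf{C}^n$. For $n\ge 2$, $P(n,N)$ denotes the collection of rational mappings $f$ from $\mathbf{C}^n$ to $\mathbf{C}^N$ (defined and holomorphic near the sphere) such that $f(S^{2n-1})\subset S^{2N-1}$. A monomial mapping is a mapping $f:\mathbf{C}^n\to\mathbf{C}^N$ each of whose component functions is a monomial $c_\alpha z^\alpha$ (multi-index notation, $c_\alpha\in\mathbf{C}$); its degree is the maximum of the degrees of its nonzero components. Two elements $f,g\in P(n,N)$ are (spherically) equivalent if there are holomorphic automorphisms $\phi$ of $\mathbf{B}_n$ and $\psi$ of $\mathbf{B}_N$ such that $g=\psi\circ f\circ\phi$; otherwise they are inequivalent. *)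

(* Defs.v *)
From mathcomp Require Import all_boot all_order all_algebra.
From mathcomp Require Import all_classical all_reals all_analysis.
From mathcomp Require Import complex.
(* The notations of mpoly clash with those of mathcomp-analysis. *)
From mathcomp Require mpoly.
Import (canonicals, coercions) mpoly.

Set Implicit Arguments.
Unset Strict Implicit.
Unset Printing Implicit Defensive.

Import Order.TTheory GRing.Theory Num.Theory.
Import numFieldNormedType.Exports.

Local Open Scope classical_set_scope.
Local Open Scope ring_scope.

(* The packaged type gives R[i] the topology and the normed-module structure that
   mathcomp-analysis attaches to every numClosedFieldType. *)
Definition C (R : realType) : numClosedFieldType := R[i].

(* C^n is 'rV[C R]_n. Its library norm is the sup norm, so the
   squared Euclidean norm is written out; the topology and the differentials are the
   same for both. *)
Definition norm2 (R : realType) (n : nat) (z : 'rV[C R]_n) : C R :=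
  \sum_(j < n) `|z ord0 j| ^+ 2.

Definition unit_sphere (R : realType) (n : nat) : set 'rV[C R]_n :=
  [set z | norm2 z = 1].

Definition unit_ball (R : realType) (n : nat) : set 'rV[C R]_n :=
  [set z | norm2 z < 1].

(* [differentiable] is taken over the field C R, that is, in the complex sense. *)
Definition holomorphic_on (R : realType) (n N : nat) (U : set 'rV[C R]_n)
    (f : 'rV[C R]_n -> 'rV[C R]_N) : Prop :=
  forall z, U z -> differentiable f z.

Definition peval (R : realType) (n : nat) (p : mpoly.mpoly n (C R))
    (z : 'rV[C R]_n) : C R :=
  mpoly.meval (fun j : 'I_n => z ord0 j) p.

Definition lowest_terms (R : realType) (n N : nat)
    (p : 'I_N -> mpoly.mpoly n (C R)) (q : mpoly.mpoly n (C R)) : Prop :=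
  forall d : mpoly.mpoly n (C R),
    (exists e, q = d * e) -> (forall i, exists e, p i = d * e) ->
    exists c : C R, d = mpoly.mpolyC n c.

(* A rational mapping is represented by a total function that agrees with p / q
   off the zero set of q; its values on that zero set are arbitrary. As p / q is
   in lowest terms, the zero set of q consists of genuine singularities. *)
Definition rational_mapping (R : realType) (n N : nat)
    (f : 'rV[C R]_n -> 'rV[C R]_N) : Prop :=
  exists (p : 'I_N -> mpoly.mpoly n (C R)) (q : mpoly.mpoly n (C R)),
    [/\ q != 0, lowest_terms p q &
        forall z, peval q z != 0 ->
          forall i, f z ord0 i = peval (p i) z / peval q z].

(* The class P(n, N); it is meant for 2 <= n. *)
Definition rational_sphere_map (R : realType) (n N : nat)
    (f : 'rV[C R]_n -> 'rV[C R]_N) : Prop :=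
  [/\ rational_mapping f,
      exists U : set 'rV[C R]_n,
        [/\ open U, @unit_sphere R n `<=` U & holomorphic_on U f] &
      forall z, @unit_sphere R n z -> @unit_sphere R N (f z)].

(* The degree is the maximum over the components with nonzero coefficient;
   c and a are determined by f up to the exponents of the zero components. *)
Definition monomial_mapping_of_degree (R : realType) (n N : nat)
    (f : 'rV[C R]_n -> 'rV[C R]_N) (d : nat) : Prop :=
  exists (c : 'I_N -> C R) (a : 'I_N -> mpoly.multinom n),
    (forall z i, f z ord0 i = c i * \prod_(j < n) z ord0 j ^+ a i j) /\
    (\max_(i < N | c i != 0%R) mpoly.mdeg (a i))%N = d.

(* Only the restriction of phi to the unit ball matters. *)
Definition ball_automorphism (R : realType) (n : nat)
    (phi : 'rV[C R]_n -> 'rV[C R]_n) : Prop :=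
  exists phi' : 'rV[C R]_n -> 'rV[C R]_n,
    [/\ holomorphic_on (@unit_ball R n) phi,
        holomorphic_on (@unit_ball R n) phi',
        forall z, @unit_ball R n z ->
          @unit_ball R n (phi z) /\ @unit_ball R n (phi' z) &
        forall z, @unit_ball R n z -> phi' (phi z) = z /\ phi (phi' z) = z].

(* A nonconstant member of P(n, N), 2 <= n, is holomorphic on the unit ball and
   maps it into the unit ball, so g = psi o f o phi is an identity on the unit
   ball of C^n. *)
Definition spherically_equivalent (R : realType) (n N : nat)
    (f g : 'rV[C R]_n -> 'rV[C R]_N) : Prop :=
  exists (phi : 'rV[C R]_n -> 'rV[C R]_n) (psi : 'rV[C R]_N -> 'rV[C R]_N),
    [/\ ball_automorphism phi, ball_automorphism psi &
        forall z, @unit_ball R n z -> g z = psi (f (phi z))].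

(* Main.v *)
(** Let L_n(x, y) = a^n + b^n with a, b the roots of t^2 = x t + y. On the line
    x + y = 1 the roots are 1 and -y, so L_n = 1 + (-y)^n there, and with
    d = 4m - 1 the polynomial L_d + y^d equals 1 on the line; it has 2m + 1 terms
    and nonnegative coefficients, so their square roots give a monomial sphere map
    f. Subtracting d x^(2m-1) y L_(2m-2) kills exactly the terms with y and y^2 and
    keeps the other coefficients nonnegative; adding back
    d x^(2m-1) y (1 + y^(2m-2)), which has the same values on the line, gives a
    second polynomial with 2m + 1 terms, hence a second map g.

    If g = psi o f o phi, then f = psi^-1 o g o phi^-1 is critical at phi(0) since
    dg(0) = 0; but the pure powers in f only allow this at 0, so phi(0) = 0 and
    psi(0) = 0. Comparing the terms of lowest order 2m, those of g are the image
    under dpsi(0) of those of f. Only the component z w^(2m-1) of f has degree 2m,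
    so the lowest order part of g would stay on a line, whereas g has the two
    components z^(2m-1) w and z w^(2m-1). *)

Require Import Defs.
From mathcomp Require Import all_boot all_order all_algebra.
From mathcomp Require Import all_classical all_reals all_analysis.
From mathcomp Require Import zify ring.
From mathcomp Require mpoly.
Import (canonicals, coercions) mpoly.
Set Implicit Arguments.
Unset Strict Implicit.
Unset Printing Implicit Defensive.
Import Order.TTheory GRing.Theory Num.Theory.
Import numFieldNormedType.Exports.
Local Open Scope classical_set_scope.
Local Open Scope ring_scope.

(** * Coefficients of the Lucas polynomials L_n *)

(* The coefficient of x^p y^k in L_(p + 2k), for p + k > 0. *)
Definition lucas (p k : nat) : nat :=
  ('C(p + k, k) + (if k is k'.+1 then 'C(p + k', k') else 0))%N.

Lemma lucas0 p : lucas p 0 = 1%N.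
Proof. by rewrite /lucas bin0. Qed.

Lemma lucas0S k : lucas 0 k.+1 = 2.
Proof. by rewrite /lucas !add0n !binn. Qed.

Lemma lucasSS p k : lucas p.+1 k.+1 = (lucas p k.+1 + lucas p.+1 k)%N.
Proof.
rewrite /lucas; case: k => [|k].
  by rewrite !addn0 !addn1 !bin0 !bin1; lia.
rewrite !addnS !addSn !binS; lia.
Qed.

(** The classical coefficient n/(k+1) C(p+k, k) of L_n, n = p + 2(k+1), with its denominator
    cleared. *)
Lemma lucas_closed p k :
  (k.+1 * lucas p k.+1 = (p + k.+1.*2) * 'C(p + k, k))%N.
Proof.
rewrite /lucas mulnDr addnS -mul_bin_diag -mulnDl; congr (_ * _)%N; lia.
Qed.

(** Written with falling factorials, the two sides compare factor by factor, by 2(b - s) <= a -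
    s. *)
Lemma leq_bin_double a b k : (b.*2 <= a)%N -> (2 ^ k * 'C(b, k) <= 'C(a, k))%N.
Proof.
move=> ab; rewrite -(leq_pmul2r (fact_gt0 k)) -mulnA !bin_ffact.
elim: k a b ab => [|k IH] a b ab; first by rewrite !ffactn0.
case: b ab => [|b] ab; first by rewrite ffact0n muln0.
case: a ab => [//|a] ab.
rewrite !ffactSS expnS mulnACA leq_mul //; first by lia.
by apply: IH; lia.
Qed.

(** For j = m - 1 this keeps the coefficients of L_d - d x^(2m-1) y L_(2m-2) nonnegative. The closed
    form of the right side contains the factor 4j + 3 = d, and binomials remain to be compared. *)
Lemma lucas_le j k : (k <= j)%N ->
  ((4 * j + 3) * lucas (2 * j - k.*2) k <= lucas (4 * j + 1 - k.*2) k.+1)%N.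
Proof.
move=> kj; rewrite -(leq_pmul2l (ltn0Sn k)) lucas_closed.
have -> : (4 * j + 1 - k.*2 + k.+1.*2 = 4 * j + 3)%N by lia.
rewrite mulnCA leq_pmul2l; last by lia.
case: k kj => [|i] ij; first by rewrite lucas0 bin0.
rewrite -(leq_pmul2l (ltn0Sn i)) mulnCA lucas_closed.
have -> : (4 * j + 1 - i.+1.*2 + i.+1 = (4 * j - i.+1).+1)%N by lia.
rewrite -mul_bin_diag.
have -> : (2 * j - i.+1.*2 + i.+1.*2 = 2 * j)%N by lia.
have -> : (2 * j - i.+1.*2 + i = 2 * j - i.+2)%N by lia.
case: i ij => [|i] ij; first by rewrite !bin0; lia.
(* The doubling bound for the binomials makes up for the excess of [i.+3 * (2 * j)] over
   [(4 * j - i.+2).+1]. *)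
have /leq_mul : ((i.+3 * (2 * j) <= (4 * j - i.+2).+1 * 2 ^ i.+1))%N.
  have : (i.+3 <= 3 * 2 ^ i)%N by elim: (i) => // n; rewrite expnS; lia.
  rewrite expnS; nia.
have dbl : ((2 * j - i.+3).*2 <= 4 * j - i.+2)%N by lia.
move=> /(_ _ _ (leq_bin_double i.+1 dbl)) /= H.
have e0 : (0 < 2 ^ i.+1)%N by rewrite expn_gt0.
rewrite -(leq_pmul2l e0); move: ('C(_, _)) ('C(_, _)) (2 ^ _)%N H => a b e; lia.
Qed.

(** An equality case of [lucas_le]; it cancels the y^2 term. *)
Lemma lucas_eq1 j : (0 < j)%N ->
  lucas (4 * j + 1 - 2) 2 = ((4 * j + 3) * lucas (2 * j - 2) 1)%N.
Proof.
move=> j0; apply/eqP; rewrite -(eqn_pmul2l (ltn0Sn 1)) lucas_closed bin1.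
have -> : lucas (2 * j - 2) 1 = (2 * j)%N.
  by have := lucas_closed (2 * j - 2) 0; rewrite bin0; lia.
have -> : (4 * j + 1 - 2 + 2.*2 = 4 * j + 3)%N by lia.
by rewrite mulnCA; apply/eqP; congr (_ * _)%N; lia.
Qed.

(** * The value of L_n on the line x + y = 1 *)

(* The guard is needed because n - k.*2 is truncated. *)
Definition lucas_term (K : comNzRingType) (x y : K) (n k : nat) : K :=
  if (k.*2 <= n)%N then (lucas (n - k.*2) k)%:R * (x ^+ (n - k.*2) * y ^+ k)
  else 0.

Lemma lucas_term0 (K : comNzRingType) (x y : K) n : lucas_term x y n 0 = x ^+ n.
Proof. by rewrite /lucas_term lucas0 subn0 !mul1r mulr1. Qed.

(** Termwise form of L_(n+2) = x L_(n+1) + y L_n. It would fail at n = 0, where L_0 = 2 but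
    [lucas 0 0] is 1. *)
Lemma lucas_termSS (K : comNzRingType) (x y : K) n k : (0 < n)%N ->
  lucas_term x y n.+2 k.+1 = x * lucas_term x y n.+1 k.+1 + y * lucas_term x y n k.
Proof.
move=> n0; rewrite /lucas_term doubleS !ltnS !subSS.
case: (ltngtP k.*2 n) => [lt|gt|eq].
- have -> : (n - k.*2.+1 = (n - k.*2).-1)%N by lia.
  have : (0 < n - k.*2)%N by lia.
  case: (n - k.*2)%N => // p _ /=.
  by rewrite lucasSS natrD !exprS; ring.
- by rewrite !mulr0 addr0.
- rewrite eq subnn; case: k eq => [|k] eq; first by rewrite -eq in n0.
  by rewrite !lucas0S !exprS; ring.
Qed.

(** Both sides obey the same recurrence, 1 and -y being the roots of t^2 = x t + y. The upper bound
    on [n] puts every term of L_n in the sum. *)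
Lemma sum_lucas_term (K : comNzRingType) (x y : K) N n : x + y = 1 ->
  (0 < n < N.*2)%N -> \sum_(k < N) lucas_term x y n k = 1 + (- y) ^+ n.
Proof.
move=> xy1 /andP[n0 nN].
(* The recurrence has order two, so two consecutive values are proved together. *)
suff: \sum_(k < N) lucas_term x y n k = 1 + (- y) ^+ n /\
      ((n.+1 < N.*2)%N -> \sum_(k < N) lucas_term x y n.+1 k = 1 + (- y) ^+ n.+1).
  by case.
have yE : y = 1 - x by rewrite -xy1 addrAC subrr add0r.
elim: n n0 N nN => // n IH _ [//|N].
case: n IH => [_ _|n IH nN].
  split=> [|N1].
    rewrite big_ord_recl lucas_term0 big1 => [|i _]; first by rewrite yE; ring.
    by rewrite /lucas_term.
  case: N N1 => // N _.
  rewrite !big_ord_recl lucas_term0 big1 => [|i _]; last by rewrite /lucas_term.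
  by rewrite /lucas_term /= lucas0S yE; ring.
case: (IH isT N.+1 (ltnW nN)) => E1 /(_ nN) E2; split=> // n3N.
rewrite big_ord_recl lucas_term0.
under eq_bigr => i _ do rewrite lucas_termSS //.
rewrite big_split /= -!mulr_sumr.
have [E3 _] := IH isT N ltac:(lia).
rewrite E3; move: E2; rewrite big_ord_recl lucas_term0 => /(canRL (addKr _)) ->.
rewrite !exprS yE; ring.
Qed.

(** * Two polynomials with 2m + 1 terms that equal 1 on the line *)

Definition bimono (K : comNzRingType) (x y : K) (e : nat * nat) : K :=
  x ^+ e.1 * y ^+ e.2.

Definition lucas_expo (m i : nat) : nat * nat :=
  if (i < 2 * m)%N then ((4 * m - 1 - i.*2)%N, i) else (0%N, (4 * m - 1)%N).

Definition lucas_coef (m i : nat) : nat :=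
  if (i < 2 * m)%N then lucas (4 * m - 1 - i.*2) i else 1%N.

(* Index i carries the monomial of L_d with y^i; the indices 1 and 2, whose terms
   vanish, are reused for the two monomials that are added back. *)
Definition alt_expo (m i : nat) : nat * nat :=
  if i == 1%N then ((2 * m - 1)%N, 1%N)
  else if i == 2%N then ((2 * m - 1)%N, (2 * m - 1)%N) else lucas_expo m i.

(** The subtracted number is d times the coefficient of y^(i-1) in L_(2m-2), whose degree in y is m
    - 1; hence the cut at [i <= m]. By [lucas_le] the truncated subtraction is exact. *)
Definition alt_coef (m i : nat) : nat :=
  if (i == 1%N) || (i == 2%N) then (4 * m - 1)%N
  else if (2 < i <= m)%N then
    (lucas_coef m i - (4 * m - 1) * lucas (2 * m - i.*2) i.-1)%N
  else lucas_coef m i.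

Lemma sum_lucas_coef (K : comNzRingType) (x y : K) m : (0 < m)%N -> x + y = 1 ->
  \sum_(i < 2 * m + 1) (lucas_coef m i)%:R * bimono x y (lucas_expo m i) = 1.
Proof.
move=> m0 xy1; rewrite addn1 big_ord_recr /= /lucas_coef /lucas_expo ltnn mul1r.
rewrite /bimono mul1r (eq_bigr (fun i : 'I__ => lucas_term x y (4 * m - 1) i)).
  rewrite sum_lucas_term //; last by lia.
  (* As d is odd, (-y)^d cancels the extra term y^d. *)
  have -> : (4 * m - 1 = (2 * m - 1).*2.+1)%N by lia.
  by rewrite exprNn -signr_odd /= odd_double expr1 mulN1r subrK.
by move=> i _; rewrite ltn_ord /lucas_term ifT //; have := ltn_ord i; lia.
Qed.

(** The term [i] of L_(2m-2) meets the term [i.+1] of L_d. For [i] = 0 and 1 it cancels it, and the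
    freed index receives a monomial that is added back; afterwards [lucas_le] makes the difference
    of coefficients a true one. *)
Lemma alt_term (K : comNzRingType) (x y : K) m i : (1 < m)%N -> (i < 2 * m - 1)%N ->
  (alt_coef m i.+1)%:R * bimono x y (alt_expo m i.+1) =
  (lucas_coef m i.+1)%:R * bimono x y (lucas_expo m i.+1)
  + (4 * m - 1)%:R * (x ^+ (2 * m - 1) * y) *
     ((if i is 0 then 1 else if i is 1 then y ^+ (2 * m - 2) else 0)
     - lucas_term x y (2 * m - 2) i).
Proof.
move=> m1 im; have im1 : (i.+1 < 2 * m)%N by lia.
rewrite /alt_coef /alt_expo /lucas_coef /lucas_expo im1 /bimono.
have le := @lucas_le m.-1 i; have eq := @lucas_eq1 m.-1.
have d1 : (4 * m.-1 + 3 = 4 * m - 1)%N by lia.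
have d2 : (4 * m.-1 + 1 = 4 * m - 3)%N by lia.
have d3 : (2 * m.-1 = 2 * m - 2)%N by lia.
rewrite d1 d2 d3 in le eq.
case: i => [|[|i]] in im im1 le *.
- rewrite /= lucas_term0.
  have -> : (4 * m - 1 - 1.*2 = 4 * m - 3)%N by lia.
  have -> : lucas (4 * m - 3) 1 = (4 * m - 1)%N.
    by have := lucas_closed (4 * m - 3) 0; rewrite bin0; lia.
  have -> : (4 * m - 3 = 2 * m - 1 + (2 * m - 2))%N by lia.
  by rewrite exprD expr1; ring.
- rewrite /= /lucas_term ifT; last by lia.
  have -> : (4 * m - 1 - 2.*2 = 4 * m - 3 - 2)%N by lia.
  rewrite eq ?natrM; last by lia.
  have -> : (4 * m - 3 - 2 = 2 * m - 1 + (2 * m - 2 - 2))%N by lia.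
  have -> : y ^+ (2 * m - 1) = y * y ^+ (2 * m - 2).
    by rewrite -exprS; congr (_ ^+ _); lia.
  by rewrite exprD expr1 expr2; ring.
- rewrite /= /lucas_term; have [im2|im2] := leqP i.+3 m; last first.
    by rewrite ifF; [ring | lia].
  rewrite ifT; last by lia.
  have -> : (2 * m - i.+3.*2 = 2 * m - 2 - i.+2.*2)%N by lia.
  have -> : (4 * m - 1 - i.+3.*2 = 4 * m - 3 - i.+2.*2)%N by lia.
  rewrite natrB; last by apply: le; lia.
  have -> : (4 * m - 3 - i.+2.*2 = 2 * m - 1 + (2 * m - 2 - i.+2.*2))%N by lia.
  by rewrite natrM exprD !exprS; ring.
Qed.

Lemma sum_alt_coef (K : comNzRingType) (x y : K) m : (1 < m)%N -> x + y = 1 ->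
  \sum_(i < 2 * m + 1) (alt_coef m i)%:R * bimono x y (alt_expo m i) = 1.
Proof.
move=> m1 xy1; rewrite -[RHS](sum_lucas_coef (ltnW m1) xy1).
have split (F : nat -> K) : \sum_(i < 2 * m + 1) F i =
    F 0%N + (\sum_(i < 2 * m - 1) F i.+1 + F (2 * m)%N).
  have -> : (2 * m + 1 = (2 * m - 1).+2)%N by lia.
  rewrite big_ord_recl big_ord_recr; congr (_ + (_ + F _)) => /=.
  by rewrite /bump leq0n add1n; lia.
rewrite (split (fun i => (alt_coef m i)%:R * bimono x y (alt_expo m i))).
rewrite (split (fun i => (lucas_coef m i)%:R * bimono x y (lucas_expo m i))).
congr (_ + (_ + _)); last first.
  by rewrite /alt_coef /alt_expo !ifF //; lia.
rewrite (eq_bigr _ (fun i _ => alt_term x y m1 (ltn_ord i))) big_split /=.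
(* The corrections sum to zero, since L_(2m-2) equals 1 + y^(2m-2) on the line. *)
rewrite -[RHS]addr0; congr (_ + _); rewrite -mulr_sumr sumrB sum_lucas_term //; last by lia.
rewrite exprNn -signr_odd; have -> : (2 * m - 2 = (m - 1).*2)%N by lia.
rewrite odd_double mul1r; have -> : (2 * m - 1 = (2 * m - 3).+2)%N by lia.
rewrite !big_ord_recl big1 // addr0 subrr mulr0 //.
Qed.

(** * Monomial maps of the sphere and the ball *)

Definition monomap (K : numClosedFieldType) N (w : nat -> nat) (e : nat -> nat * nat)
    (z : 'rV[K]_2) : 'rV[K]_N :=
  \row_i (sqrtC (w i)%:R * bimono (z ord0 ord0) (z ord0 ord_max) (e i)).

Lemma big_ord2E (T : Type) (idx : T) (op : Monoid.law idx) (F : 'I_2 -> T) :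
  \big[op/idx]_(i < 2) F i = op (F ord0) (F ord_max).
Proof.
rewrite big_ord_recr big_ord1; congr (op (F _) _); exact: val_inj.
Qed.

(** Squared moduli remove the square roots of the weights and turn the sphere into the line x + y =
    1. *)
Lemma norm2_monomap (R : realType) N w e (z : 'rV[C R]_2) :
  norm2 (@monomap (C R) N w e z) =
  \sum_(i < N) (w i)%:R * bimono (`|z ord0 ord0| ^+ 2) (`|z ord0 ord_max| ^+ 2) (e i).
Proof.
apply: eq_bigr => i _; rewrite mxE !normrM !exprMn !normrX -!exprM.
rewrite ger0_norm ?sqrtC_ge0 ?ler0n // sqrtCK.
by rewrite ![(_ * 2)%N]mulnC /bimono !exprM.
Qed.

Definition bimnm (e : nat * nat) : mpoly.multinom 2 :=
  mpoly.Multinom [tuple (if j == ord0 :> 'I_2 then e.1 else e.2) | j < 2].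

Lemma bimnmE e (j : 'I_2) : bimnm e j = if j == ord0 then e.1 else e.2.
Proof. exact: mpoly.mnmE. Qed.

Lemma mdeg_bimnm e : mpoly.mdeg (bimnm e) = (e.1 + e.2)%N.
Proof. by rewrite mpoly.mdegE big_ord2E !bimnmE. Qed.

Lemma prod_bimnm (K : numClosedFieldType) (z : 'rV[K]_2) e :
  \prod_(j < 2) z ord0 j ^+ bimnm e j = bimono (z ord0 ord0) (z ord0 ord_max) e.
Proof. by rewrite big_ord2E !bimnmE. Qed.

Lemma monomap_rational (R : realType) N w e : rational_mapping (@monomap (C R) N w e).
Proof.
exists (fun i => mpoly.mpolyC 2 (sqrtC (w i)%:R) * mpoly.mpolyX _ (bimnm (e i))), 1.
split; first exact: oner_neq0.
  move=> d [d' dd'] _; exists (mpoly.mcoeff mpoly.mnm0 d); apply/eqP.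
  have := @mpoly.mpoly_intro_unit 2 (C R) d d'; rewrite mulrC -dd' => /(_ erefl).
  by case/andP.
move=> z _ i; rewrite mxE /peval mpoly.meval1 divr1 mpoly.mevalM mpoly.mevalC.
by rewrite mpoly.mevalX prod_bimnm.
Qed.

Lemma monomap_differentiable (K : numClosedFieldType) N w e z :
  differentiable (@monomap K N w e) z.
Proof.
pose F (i : 'I_N) (y : 'rV[K]_2) : 'rV[K]_N :=
  (sqrtC (w i)%:R * bimono (y ord0 ord0) (y ord0 ord_max) (e i)) *: delta_mx ord0 i.
have -> : @monomap K N w e = \sum_(i < N) F i.
  apply/funext => y; rewrite fct_sumE [LHS]row_sum_delta.
  by apply: eq_bigr => i _; rewrite mxE.
apply: differentiable_sum => i; apply: differentiableZl.
apply: differentiableM; first exact: differentiable_cst.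
have dX j k : differentiable (fun y : 'rV[K]_2 => y ord0 j ^+ k) z.
  elim: k => [|k IH]; first exact: differentiable_cst.
  under eq_fun do rewrite exprS.
  by apply: differentiableM => //; exact: differentiable_coord.
by apply: differentiableM; apply: dX.
Qed.

Lemma monomap_sphere (R : realType) N (w : nat -> nat) (e : nat -> nat * nat) :
  (forall x y : C R, x + y = 1 -> \sum_(i < N) (w i)%:R * bimono x y (e i) = 1) ->
  rational_sphere_map (@monomap (C R) N w e).
Proof.
move=> sum1; split; first exact: monomap_rational.
  exists setT; split=> // [|z _]; [exact: openT|exact: monomap_differentiable].
move=> z; rewrite /unit_sphere /= norm2_monomap => z1; apply: sum1.
by rewrite -z1 /norm2 big_ord2E.
Qed.

Lemma monomap_degree (R : realType) N (w : nat -> nat) (e : nat -> nat * nat) d :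
  (forall i, (i < N)%N -> ((e i).1 + (e i).2 <= d)%N) ->
  (exists2 i, (i < N)%N & (w i != 0)%N /\ ((e i).1 + (e i).2 = d)%N) ->
  monomial_mapping_of_degree (@monomap (C R) N w e) d.
Proof.
move=> le_d [i0 iN [wi0 ei0]].
exists (fun i => sqrtC (w i)%:R), (fun i => bimnm (e i)); split=> [z i|].
  by rewrite mxE prod_bimnm.
apply/eqP; rewrite eqn_leq; apply/andP; split.
  by apply/bigmax_leqP => i _; rewrite mdeg_bimnm le_d.
rewrite -ei0 -mdeg_bimnm; apply: (@leq_bigmax_cond _ _ _ (Ordinal iN)).
by rewrite sqrtC_eq0 pnatr_eq0.
Qed.

(** With s = x + y > 0, a monomial of degree n >= 1 is s^n <= s times its value at the point (x/s,
    y/s) of the line, so the sum is at most s < 1. *)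
Lemma sum_bimono_lt1 (K : numFieldType) N (w : nat -> nat) (e : nat -> nat * nat)
    (x y : K) :
  (forall x y : K, x + y = 1 -> \sum_(i < N) (w i)%:R * bimono x y (e i) = 1) ->
  (forall i, (i < N)%N -> (0 < (e i).1 + (e i).2)%N) ->
  0 <= x -> 0 <= y -> x + y < 1 ->
  \sum_(i < N) (w i)%:R * bimono x y (e i) < 1.
Proof.
move=> sum1 e0 x0 y0 xy1.
have s0 : 0 <= x + y by rewrite addr_ge0.
have [xy0|xy0] := eqVneq (x + y) 0.
  move/eqP: xy0; rewrite paddr_eq0 // => /andP[/eqP-> /eqP->].
  rewrite big1 // => i _; rewrite /bimono; have := e0 i (ltn_ord i).
  by case: (e i) => [[|a] [|b]] //= _; rewrite ?exprS !(mul0r, mulr0).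
have sum_1 : x / (x + y) + y / (x + y) = 1 by rewrite -mulrDl divff.
apply: le_lt_trans (xy1); rewrite -[leRHS]mulr1 -[X in _ <= _ * X](sum1 _ _ sum_1) mulr_sumr.
apply: ler_sum => i _; rewrite [leRHS]mulrCA ler_wpM2l ?ler0n //.
rewrite /bimono !expr_div_n.
have s_gt0 : 0 < x + y by rewrite lt_def xy0.
have -> a b (p q s : K) : p / s ^+ a * (q / s ^+ b) = p * q / s ^+ (a + b).
  by rewrite exprD invfM; ring.
rewrite [leRHS]mulrCA ler_peMr ?mulr_ge0 ?exprn_ge0 //.
rewrite ler_pdivlMr ?exprn_gt0 // mul1r.
have := e0 i (ltn_ord i); case: (_ + _)%N => // n _.
rewrite exprS ler_piMr // exprn_ile1 //; exact: ltW.
Qed.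

Lemma monomap_ball (R : realType) N (w : nat -> nat) (e : nat -> nat * nat) z :
  (forall x y : C R, x + y = 1 -> \sum_(i < N) (w i)%:R * bimono x y (e i) = 1) ->
  (forall i, (i < N)%N -> (0 < (e i).1 + (e i).2)%N) ->
  @unit_ball R 2 z -> @unit_ball R N (@monomap (C R) N w e z).
Proof.
move=> sum1 e0; rewrite /unit_ball /= norm2_monomap [norm2 z]/norm2 big_ord2E /=.
by apply: sum_bimono_lt1; rewrite ?exprn_ge0.
Qed.

(** * Difference quotients and lowest-order terms *)

(** The increment may be nonlinear in [t]: later [s t] is a power t^d and [Y t] a rescaled monomial
    map. As [Y] stays bounded, the remainder is still o(s). *)
Lemma differentiable_quot (K : numFieldType) (V W : normedModType K) (T : Type)
    (F : set_system T) {FF : Filter F} (psi : V -> W) (a : V) (s : T -> K)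
    (Y : T -> V) (Y0 : V) :
  differentiable psi a -> s @ F --> (0 : K) -> (\forall t \near F, s t != 0) ->
  Y @ F --> Y0 ->
  (fun t => (s t)^-1 *: (psi (a + s t *: Y t) - psi a)) @ F --> 'd psi a Y0.
Proof.
move=> dpsi s0 sN0 YY0.
have [r [rE rP]] : exists r : V -> W, (forall h, psi (a + h) = psi a + 'd psi a h + r h) /\
    forall eps, 0 < eps -> \forall h \near nbhs (0 : V), `|r h| <= eps * `|h|.
  eexists; split; first exact: (diff_locallyxC dpsi).
  by apply/eqoP; exact: littleo_eqo.
have sY0 : (fun t => s t *: Y t) @ F --> (0 : V).
  by rewrite -(scale0r Y0); apply: cvgZ.
have -> : 'd psi a Y0 = 'd psi a Y0 + 0 by rewrite addr0.
have E : {near F, (fun t => 'd psi a (Y t) + (s t)^-1 *: r (s t *: Y t)) =1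
    (fun t => (s t)^-1 *: (psi (a + s t *: Y t) - psi a))}.
  near=> t; have st0 : s t != 0 by near: t.
  rewrite /= rE -[psi a + _ + _]addrA [X in X - _]addrC addrK.
  by rewrite scalerDr linearZ /= scalerA mulVf // scale1r.
apply: cvg_trans (near_eq_cvg E) _; apply: cvgD.
  by apply: continuous_cvg => //; exact: diff_continuous dpsi Y0.
apply/cvgr0Pnorm_le => eps eps0.
pose M := `|Y0| + 1; have M0 : 0 < M by rewrite ltr_wpDl.
have {}rP := rP _ (divr_gt0 eps0 M0).
near=> t; have st0 : s t != 0 by near: t.
have YM : `|Y t| <= M.
  rewrite -(subrK Y0 (Y t)) addrC (le_trans (ler_normD _ _)) // lerD2l.
  by rewrite distrC; near: t; have /cvgrPdist_le/(_ 1 ltr01) := YY0.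
have rt : `|r (s t *: Y t)| <= eps / M * `|s t *: Y t|.
  by near: t; exact: (sY0 _ rP).
have s0' : 0 < `|s t| by rewrite normr_gt0.
rewrite normrZ normfV ler_pdivrMl // (le_trans rt) // normrZ mulrCA.
rewrite ler_wpM2l ?(ltW s0') // mulrAC ler_pdivrMr // ler_wpM2l // ltW.
Unshelve. all: by end_near. Qed.

Lemma cvg_row (K : numFieldType) (T : Type) (F : set_system T) {FF : Filter F}
    n (Y : T -> 'rV[K]_n) (Y0 : 'rV[K]_n) :
  (forall j, (fun t => Y t ord0 j) @ F --> Y0 ord0 j) -> Y @ F --> Y0.
Proof.
move=> YY0 A [P PY sPA]; apply: (@filterS _ F _ [set t | forall j, P ord0 j (Y t ord0 j)]).
  by move=> t Pt; apply: sPA => i j; rewrite ord1.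
by apply: filter_forall => j; apply: YY0; exact: PY.
Qed.

Lemma cvg_exprn (K : numFieldType) (T : Type) (F : set_system T) {FF : Filter F}
    (f : T -> K) (a : K) n : f @ F --> a -> (fun t => f t ^+ n) @ F --> a ^+ n.
Proof.
move=> fa; elim: n => [|n IH]; first exact: cvg_cst.
by under eq_fun do rewrite exprS; rewrite exprS; exact: cvgM.
Qed.

(** A term of degree n contributes t^(n-d) times its value at W(t), so only the terms of degree d
    survive. *)
Lemma monomap_blowup (K : numClosedFieldType) N (w : nat -> nat) (e : nat -> nat * nat) d
    (W : K -> 'rV[K]_2) (W0 : 'rV[K]_2) :
  (forall i, (i < N)%N -> (d <= (e i).1 + (e i).2)%N) ->
  W @ (0 : K)^' --> W0 ->
  (fun t => (t ^+ d)^-1 *: @monomap K N w e (t *: W t)) @ (0 : K)^' -->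
  @monomap K N (fun i => if (e i).1 + (e i).2 == d then w i else 0)%N e W0.
Proof.
move=> led WW0; apply: cvg_row => i; rewrite mxE.
have coord j : (fun t => W t ord0 j) @ (0 : K)^' --> W0 ord0 j.
  exact: (continuous_cvg _ (@coord_continuous _ _ _ _ _ _) WW0).
set v := (v in _ --> v).
(* The power of 0 is 1 in degree d and 0 above it. *)
have -> : v = sqrtC (w i)%:R * (0 ^+ ((e i).1 + (e i).2 - d) *
    bimono (W0 ord0 ord0) (W0 ord0 ord_max) (e i)).
  rewrite /v; have := led i (ltn_ord i); case: ltngtP => // h _.
    by rewrite sqrtC0 mul0r expr0n subn_eq0 leqNgt h mul0r mulr0.
  by rewrite h subnn mul1r.
have E : {near (0 : K)^', (fun t => sqrtC (w i)%:R * (t ^+ ((e i).1 + (e i).2 - d) *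
    bimono (W t ord0 ord0) (W t ord0 ord_max) (e i))) =1
    (fun t => ((t ^+ d)^-1 *: @monomap K N w e (t *: W t)) ord0 i)}.
  near=> t; have t0 : t != 0 by near: t; exact: nbhs_dnbhs_neq.
  rewrite /= !mxE [RHS]mulrCA; congr (_ * _); rewrite /bimono !exprMn.
  rewrite [X in _ = _ * X]mulrACA -exprD.
  by rewrite [RHS]mulrA [_^-1 * _]mulrC -expfB_cond // (negPf t0) led.
apply: cvg_trans (near_eq_cvg E) _; apply: cvgM; first exact: cvg_cst.
have t0 : (fun t : K => t) @ (0 : K)^' --> (0 : K) by exact: nbhs_dnbhs.
by apply: cvgM; [exact: cvg_exprn | apply: cvgM; exact: cvg_exprn].
Unshelve. all: by end_near. Qed.

Lemma monomap0 (K : numClosedFieldType) N (w : nat -> nat) (e : nat -> nat * nat) :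
  (forall i, (i < N)%N -> (0 < (e i).1 + (e i).2)%N) -> @monomap K N w e 0 = 0.
Proof.
move=> e0; apply/rowP => i; rewrite !mxE /bimono -exprD expr0n.
by rewrite gtn_eqF ?e0 // mulr0.
Qed.

(** A chain rule for terms of order d: [W t], the difference quotient of [phi], feeds the blow-up of
    the monomial map, which feeds the quotient of [psi] at scale t^d. *)
Lemma comp_monomap_blowup (K : numClosedFieldType) N (w : nat -> nat)
    (e : nat -> nat * nat) d (phi : 'rV[K]_2 -> 'rV[K]_2) (psi : 'rV[K]_N -> 'rV[K]_N)
    (a v : 'rV[K]_2) :
  (0 < d)%N -> (forall i, (i < N)%N -> (d <= (e i).1 + (e i).2)%N) ->
  differentiable phi a -> phi a = 0 -> differentiable psi 0 ->
  (fun t => (t ^+ d)^-1 *: (psi (monomap N w e (phi (a + t *: v))) - psi 0))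
    @ (0 : K)^' -->
  'd psi 0 (monomap N (fun i => if (e i).1 + (e i).2 == d then w i else 0)%N e
              ('d phi a v)).
Proof.
move=> d0 led dphi phia dpsi.
have t0 : (fun t : K => t) @ (0 : K)^' --> (0 : K) by exact: nbhs_dnbhs.
have tN0 : \forall t \near (0 : K)^', t != 0 by exact: nbhs_dnbhs_neq.
pose W t := t^-1 *: (phi (a + t *: v) - phi a).
have WW0 : W @ (0 : K)^' --> 'd phi a v.
  by apply: (differentiable_quot dphi t0 tN0); exact: cvg_cst.
have Y0 := monomap_blowup (w := w) led WW0.
have td0 : (fun t : K => t ^+ d) @ (0 : K)^' --> (0 : K) ^+ d by exact: cvg_exprn.
rewrite expr0n (gtn_eqF d0) in td0.
have tdN0 : \forall t \near (0 : K)^', t ^+ d != 0.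
  by apply: filterS tN0 => t; exact: expf_neq0.
apply: cvg_trans (differentiable_quot dpsi td0 tdN0 Y0).
apply: near_eq_cvg; near=> t; have tn0 : t != 0 by near: t.
rewrite /= add0r scalerA divff ?expf_neq0 // scale1r /W scalerA divff // scale1r.
by rewrite phia subr0.
Unshelve. all: by end_near. Qed.

(** * Obstructions to equivalence *)

(** The component with the pure power has partial derivative a nonzero multiple of p_j^(n-1). *)
Lemma monomap_critical (K : numClosedFieldType) N (w : nat -> nat)
    (e : nat -> nat * nat) (p : 'rV[K]_2) (j : 'I_2) i n :
  (i < N)%N -> w i != 0%N -> (0 < n)%N ->
  e i = (if j == ord0 then (n, 0%N) else (0%N, n)) ->
  (fun t => t^-1 *: (monomap N w e (p + t *: delta_mx ord0 j) - monomap N w e p))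
    @ (0 : K)^' --> (0 : 'rV[K]_N) ->
  p ord0 j = 0.
Proof.
move=> iN wi0 n0 ei lim0.
have bim (x : 'rV[K]_2) : bimono (x ord0 ord0) (x ord0 ord_max) (e i) = x ord0 j ^+ n.
  rewrite ei /bimono; case: (unliftP ord0 j) => [j'|] ->; rewrite ?mulr1 //=.
  by rewrite mul1r; congr (x _ _ ^+ _); apply: val_inj; rewrite ord1.
have mE (x : 'rV[K]_2) : monomap N w e x ord0 (Ordinal iN) = sqrtC (w i)%:R * x ord0 j ^+ n.
  by rewrite mxE bim.
pose q t := (t^-1 *: (monomap N w e (p + t *: delta_mx ord0 j) - monomap N w e p))
  ord0 (Ordinal iN).
have q0 : (0 : 'rV[K]_N) ord0 (Ordinal iN) = 0 by rewrite mxE.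
have lim1 : q @ (0 : K)^' --> (0 : 'rV[K]_N) ord0 (Ordinal iN).
  exact: (continuous_cvg _ (@coord_continuous _ _ _ _ _ _) lim0).
rewrite q0 in lim1.
have : (fun t => sqrtC (w i)%:R * (t^-1 *: ((t *: 1 + p ord0 j) ^+ n - p ord0 j ^+ n)))
    @ (0 : K)^' --> sqrtC (w i)%:R * (n%:R *: p ord0 j ^+ n.-1 *: (1 : K)).
  apply: cvgM; first exact: cvg_cst.
  by have := @exprn_derivable K n (p ord0 j) 1; rewrite /derivable -exp_derive.
have -> : (fun t => sqrtC (w i)%:R *
     (t^-1 *: ((t *: 1 + p ord0 j) ^+ n - p ord0 j ^+ n))) =
   q.
  apply/funext => t; rewrite /q mxE [X in _ = _ * X]mxE mE [X in _ = _ * (_ + X)]mxE mE.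
  rewrite -mulrBr [RHS]mulrCA !mxE !eqxx.
  by rewrite [t *: 1 + _]addrC.
move=> lim2; have /(_ _)/esym/eqP := @norm_cvg_unique _ _ _ _ _ _ lim1 lim2.
rewrite mulf_eq0 sqrtC_eq0 pnatr_eq0 (negPf wi0) /= mulf_eq0 oner_eq0 orbF mulf_eq0 pnatr_eq0 gtn_eqF //=.
by rewrite expf_eq0 => /andP[_ /eqP].
Qed.

(** Between the points (1, 1) and (1, 2) the ratio of the components [i] and [j] changes by 2^((e
    i).2 - (e j).2); on a line it would be constant. *)
Lemma monomap_not_proportional (K : numClosedFieldType) N (w : nat -> nat)
    (e : nat -> nat * nat) (B : 'rV[K]_N) i j :
  (i < N)%N -> (j < N)%N -> w i != 0%N -> w j != 0%N -> (e i).2 != (e j).2 ->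
  ~ (forall v, exists c, monomap N w e v = c *: B).
Proof.
move=> iN jN wi wj eij H.
have [c1 /rowP E1] := H (\row_(k < 2) 1).
have [c2 /rowP E2] := H (\row_(k < 2) (if k == ord0 then 1 else 2%:R)).
have := E1 (Ordinal iN); have := E1 (Ordinal jN).
have := E2 (Ordinal iN); have := E2 (Ordinal jN).
rewrite !mxE /bimono !expr1n /= !mul1r !mulr1 => Ej2 Ei2 Ej1 Ei1.
have : c1 * B ord0 (Ordinal iN) * (c2 * B ord0 (Ordinal jN)) =
  c2 * B ord0 (Ordinal iN) * (c1 * B ord0 (Ordinal jN)) by ring.
rewrite -Ei1 -Ei2 -Ej1 -Ej2 mulrA [RHS]mulrAC => /mulfI.
rewrite mulf_neq0 ?sqrtC_eq0 ?pnatr_eq0 // => /(_ isT)/eqP.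
by rewrite -!natrX eqr_nat eqn_exp2l // eq_sym (negPf eij).
Qed.

Lemma near_sum_normX2_lt1 (K : numClosedFieldType) (p v : 'rV[K]_2) :
  \sum_(j < 2) `|p ord0 j| ^+ 2 < 1 ->
  \forall t \near (0 : K)^', \sum_(j < 2) `|(p + t *: v) ord0 j| ^+ 2 < 1.
Proof.
move=> p1.
have t0 : (fun t : K => t) @ (0 : K)^' --> (0 : K) by exact: nbhs_dnbhs.
have c j : (fun t : K => `|(p + t *: v) ord0 j| ^+ 2) @ (0 : K)^' --> `|p ord0 j| ^+ 2.
  apply: cvg_exprn; apply: cvg_norm.
  rewrite -[p ord0 j]addr0 -[X in _ + X](mul0r (v ord0 j)).
  under eq_fun do rewrite !mxE.
  by apply: cvgD; [exact: cvg_cst|apply: cvgM => //; exact: cvg_cst].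
have lim : (fun t : K => \sum_(j < 2) `|(p + t *: v) ord0 j| ^+ 2) @ (0 : K)^' -->
    \sum_(j < 2) `|p ord0 j| ^+ 2.
  by rewrite big_ord2E; under eq_fun do rewrite big_ord2E; apply: cvgD; exact: c.
have /cvgrPdist_lt/(_ (1 - \sum_(j < 2) `|p ord0 j| ^+ 2)) := lim.
rewrite subr_gt0 => /(_ p1); apply: filterS => t; rewrite distrC => H.
rewrite -(ltrD2r (- \sum_(j < 2) `|p ord0 j| ^+ 2)); apply: le_lt_trans H.
by apply: real_ler_norm; apply: rpredB; apply: ger0_real; apply: sumr_ge0 => j _;
  rewrite exprn_ge0.
Qed.

Lemma near_unit_ball (R : realType) (p v : 'rV[C R]_2) : @unit_ball R 2 p ->
  \forall t \near (0 : C R)^', @unit_ball R 2 (p + t *: v).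
Proof. exact: near_sum_normX2_lt1. Qed.

(** The indices [k1] and [k2] carry the pure powers of [f], and only [k] can carry degree d there;
    [i] and [j] are two terms of degree d in the second map. *)
Lemma monomap_inequivalent (R : realType) N (w w' : nat -> nat)
    (e e' : nat -> nat * nat) d n k1 k2 k i j :
  let f := @monomap (C R) N w e in
  (1 < d)%N -> (0 < n)%N ->
  (forall z, @unit_ball R 2 z -> @unit_ball R N (f z)) ->
  (forall l, (l < N)%N -> (d <= (e l).1 + (e l).2)%N) ->
  (forall l, (l < N)%N -> (d <= (e' l).1 + (e' l).2)%N) ->
  (k1 < N)%N -> w k1 != 0%N -> e k1 = (n, 0%N) ->
  (k2 < N)%N -> w k2 != 0%N -> e k2 = (0%N, n) ->
  (forall l, (l < N)%N -> ((e l).1 + (e l).2 = d)%N -> l = k) ->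
  (i < N)%N -> w' i != 0%N -> ((e' i).1 + (e' i).2 = d)%N ->
  (j < N)%N -> w' j != 0%N -> ((e' j).1 + (e' j).2 = d)%N ->
  (e' i).2 != (e' j).2 ->
  ~ spherically_equivalent f (@monomap (C R) N w' e').
Proof.
set g := monomap N w' e'.
move=> f d1 n0 fball led led' k1N wk1 ek1 k2N wk2 ek2 ek iN wi ei jN wj ej eij.
move=> [phi [psi [[phi' [dphi dphi' phiB phiK]] [psi' [dpsi dpsi' psiB psiK]] gE]]].
have ball0 n' : @unit_ball R n' 0.
  by rewrite /unit_ball /= /norm2 big1 // => l _; rewrite mxE normr0 expr0n.
have d0 : (0 < d)%N by exact: ltnW.
have f0 : f 0 = 0 by apply: monomap0 => l /led; exact: leq_trans.
have g0 : g 0 = 0 by apply: monomap0 => l /led'; exact: leq_trans.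
set p := phi 0.
have pB : @unit_ball R 2 p by case: (phiB 0).
have fE z : @unit_ball R 2 z -> f z = psi' (g (phi' z)).
  move=> zB; have [phizB phi'zB] := phiB z zB.
  rewrite gE // (phiK z zB).2 (psiK _ _).1 //; exact: fball.
have phi'p : phi' p = 0 by rewrite (phiK 0 _).1.
have fp : f p = psi' 0 by rewrite fE // phi'p g0.
(* As d > 1, [g] has no part of degree 1, so the blow-up of psi' o g o phi' with exponent 1 tends to
   0. *)
have crit v : (fun t => t^-1 *: (f (p + t *: v) - f p)) @ (0 : C R)^' -->
    (0 : 'rV[C R]_N).
  have := @comp_monomap_blowup _ N w' e' 1 phi' psi' p v isT _ (dphi' _ pB) phi'p
    (dpsi' _ (ball0 _)).
  set h := monomap _ _ _ _; have -> : h = 0.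
    apply/rowP => l; rewrite !mxE ifF ?sqrtC0 ?mul0r //.
    by have := led' l (ltn_ord l); lia.
  rewrite linear0 => lim; apply: cvg_trans (lim _); last first.
    by move=> l /led'; exact: leq_trans.
  apply: near_eq_cvg; near=> t.
  have tB : @unit_ball R 2 (p + t *: v) by near: t; exact: near_unit_ball.
  by rewrite /= expr1 fp fE.
have p0 : p = 0.
  apply/rowP => l; rewrite mxE; case: (unliftP ord0 l) => [l'|] ->.
    by apply: (monomap_critical k2N wk2 n0 _ (crit _)); rewrite ek2.
  by apply: (monomap_critical k1N wk1 n0 _ (crit _)); rewrite ek1.
have psi0 : psi 0 = 0 by rewrite -{1}f0 -p0 -gE.
pose w0 l := (if (e l).1 + (e l).2 == d then w l else 0)%N.
pose w1 l := (if (e' l).1 + (e' l).2 == d then w' l else 0)%N.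
(* The part of [f] of degree d lies on the axis [k], and ['d psi 0] maps this axis into a line. *)
apply: (@monomap_not_proportional (C R) N w1 e'
  ('d psi 0 (\row_l (nat_of_ord l == k)%:R)) i j) => //.
- by rewrite /w1 ei eqxx.
- by rewrite /w1 ej eqxx.
move=> v; set u := 'd phi 0 v.
exists (sqrtC (w0 k)%:R * bimono (u ord0 ord0) (u ord0 ord_max) (e k)).
rewrite -linearZ /=.
(* The limit of t^(-d) g(tv) is computed twice, through psi o f o phi and directly. *)
have lim1 := @comp_monomap_blowup _ N w e d phi psi 0 v d0 led (dphi _ (ball0 _)) p0
  (dpsi _ (ball0 _)).
have lim2 : (fun t => (t ^+ d)^-1 *: g (t *: v)) @ (0 : C R)^' --> monomap N w1 e' v.
  exact: (monomap_blowup (w := w') led' (cvg_cst v)).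
have {}lim1 : (fun t => (t ^+ d)^-1 *: g (t *: v)) @ (0 : C R)^' -->
    'd psi 0 (monomap N w0 e u).
  apply: cvg_trans lim1; apply: near_eq_cvg; near=> t.
  have tB : @unit_ball R 2 (0 + t *: v) by near: t; exact: near_unit_ball.
  by rewrite /= psi0 subr0 -(gE _ tB) [0 + _]add0r.
have /(_ _) -> := @norm_cvg_unique _ _ _ _ _ _ lim2 lim1.
congr ('d psi 0 _); apply/rowP => l; rewrite !mxE.
have [->|lk] := eqVneq (nat_of_ord l) k; first by rewrite mulr1.
rewrite /w0 ifF ?sqrtC0 ?mul0r ?mulr0 //; apply: contraNF lk => /eqP lk.
exact/eqP/ek.
Unshelve. all: by end_near. Qed.

(** * The two maps of degree 4m - 1 *)

Theorem theorem2 (R : realType) (m : nat) (hm : (2 <= m)%N) :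
  exists f g : 'rV[C R]_2 -> 'rV[C R]_(2 * m + 1),
    [/\ rational_sphere_map f /\ rational_sphere_map g,
        monomial_mapping_of_degree f (4 * m - 1),
        monomial_mapping_of_degree g (4 * m - 1) &
        ~ spherically_equivalent f g].
Proof.
have lucas_sum (x y : C R) := @sum_lucas_coef (C R) x y m (ltnW hm).
have alt_sum (x y : C R) := @sum_alt_coef (C R) x y m hm.
(* The term i < 2m of L_d has degree d - i, hence at least 2m. *)
have lucas_deg i : (i < 2 * m + 1)%N ->
    (2 * m <= (lucas_expo m i).1 + (lucas_expo m i).2 <= 4 * m - 1)%N.
  by move=> iN; rewrite /lucas_expo; case: ifP => h /=; lia.
have alt_deg i : (i < 2 * m + 1)%N ->
    (2 * m <= (alt_expo m i).1 + (alt_expo m i).2 <= 4 * m - 1)%N.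
  by move=> /lucas_deg; rewrite /alt_expo; do 2?case: ifP => _ //=; lia.
have coef0 : lucas_coef m 0 != 0%N.
  by rewrite /lucas_coef lucas0 if_same.
have expo0 : lucas_expo m 0 = ((4 * m - 1)%N, 0%N).
  by rewrite /lucas_expo ifT ?subn0 //; lia.
have coef2m : lucas_coef m (2 * m) != 0%N by rewrite /lucas_coef ltnn.
have expo2m : lucas_expo m (2 * m) = (0%N, (4 * m - 1)%N) by rewrite /lucas_expo ltnn.
(* As m >= 2, the index 2m - 1 exceeds both 2 and m, so its term is the same in both maps. *)
have alt_coef_last : alt_coef m (2 * m - 1) != 0%N.
  rewrite /alt_coef !ifF; try by lia.
  rewrite /lucas_coef ifT; last by lia.
  by rewrite -lt0n /lucas addn_gt0 bin_gt0 leq_addl.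
have alt_expo_last : alt_expo m (2 * m - 1) = (1%N, (2 * m - 1)%N).
  rewrite /alt_expo !ifF; try by lia.
  rewrite /lucas_expo ifT; last by lia.
  by congr (_, _); lia.
exists (monomap _ (lucas_coef m) (lucas_expo m)), (monomap _ (alt_coef m) (alt_expo m)).
split.
- by split; apply: monomap_sphere.
- apply: monomap_degree => [i /lucas_deg/andP[] //|].
  by exists 0%N; rewrite ?expo0 //=; lia.
- apply: monomap_degree => [i /alt_deg/andP[] //|].
  by exists 0%N; rewrite /alt_coef /alt_expo /= ?expo0 //=; lia.
(* In [f] the pure powers have indices 0 and 2m, and degree 2m occurs only at 2m - 1. In [g] it
   occurs at 1 and 2m - 1, with exponents 1 and 2m - 1 of the second variable. *)
apply: (@monomap_inequivalent R _ _ _ _ _ (2 * m) (4 * m - 1) 0 (2 * m) (2 * m - 1)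
          1 (2 * m - 1)) => //; try by lia.
- move=> z; apply: monomap_ball => // i /lucas_deg; lia.
- by move=> l /lucas_deg/andP[].
- by move=> l /alt_deg/andP[].
- by move=> l; rewrite /lucas_expo; case: ifP => /= *; lia.
- by rewrite /alt_coef /=; lia.
- by rewrite /alt_expo /=; lia.
- by rewrite alt_expo_last /=; lia.
- by rewrite alt_expo_last /alt_expo /=; lia.
Qed.
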